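(* Let $A$ be either $\mathbb{H}$ or $\mathbb{O}$. Let $\Omega\subset A$ be an unbounded circular domain and let $f:\Omega\to A$ be a slice-Nash function on $\Omega$. Then there exist an integer $m\ge 0$ and constants $C,R\ge 1$ such that $$\|f(x)\|\le C(1+\|x\|^m)$$ for each $x\in\Omega$ such that $\|x\|\ge R$.
   Context: $\mathbb{H}$ (quaternions) and $\mathbb{O}$ (octonions) carry the standard conjugation $x\mapsto x^c$; $\|x\|=\sqrt{xx^c}$ is the Euclidean norm; $\mathbb{S}_A=\{I\in A: I^2=-1\}$. Put $u_A=1$ if $A=\mathbb{H}$ and $u_A=3$ if $A=\mathbb{O}$. The complex field is $\mathbb{C}=\{\alpha+\iota\beta\}$ with $\iota\notin\mathbb{S}_A$. For $I\in\mathbb{S}_A$, $\mathbb{C}_I=\mathbb{R}+\mathbb{R}I$. For $D\subset\mathbb{C}$, $\Omega_D=\{\alpha+\beta I:\alpha+\iota\beta\in D,\ I\in\mathbb{S}_A\}$; $\Omega\subset A$ is circular if $\Omega=\Omega_D$ for some $D$, where $D$ is always taken invariant under complex conjugation (then it is determined by $\Omega$). A circular domain is an open connected circular set. Elements of $A\otimes_{\mathbb{R}}\mathbb{C}$ are $x+\iota y$ ($x,y\in A$), with $\overline{x+\iota y}=x-\iota y$. A stem function on an open conjugation-invariant $D\subset\mathbb{C}$ is $F=F_1+\iota F_2:D\to A\otimes_{\mathbb{R}}\mathbb{C}$ with $F(\overline z)=\overline{F(z)}$. It induces the slice function $f=\mathcal{I}(F):\Omega_D\to A$, $f(\alpha+\beta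 I)=F_1(\alpha+\iota\beta)+I\,F_2(\alpha+\iota\beta)$; every slice function comes from a unique stem function. $f$ is slice regular if $F$ is holomorphic, i.e. $C^1$ with $\frac{\partial F}{\partial\alpha}+\iota\frac{\partial F}{\partial\beta}=0$. A function $g:D\to\mathbb{C}$ on an open $D\subset\mathbb{C}$ is complex Nash if every point of $D$ has an open neighbourhood $U\subset D$ on which $g$ is holomorphic and satisfies $P(z,g(z))=0$ for some non-zero $P\in\mathbb{C}[z,t]$. For $I\in\mathbb{S}_A$, $A$ is a $\mathbb{C}_I$-vector space by left multiplication; if $\{1,I_1,\ldots,I_{u_A}\}$ is a base over $\mathbb{C}_I$, then $\{I_0:=1,I,I_1,II_1,\ldots,I_{u_A},II_{u_A}\}$ is called a splitting base of $A$ associated to $I$. Write uniquely $F_s=\sum_{k=0}^{u_A}(F_{s,1}^{I,I_k}+F_{s,2}^{I,I_k}I)I_k$ ($s=1,2$) with real-valued coefficients, and $F^{\ell}_{I,I_k}=F_{1,\ell}^{I,I_k}+\iota F_{2,\ell}^{I,I_k}:D\to\mathbb{C}$ ($\ell=1,2$). $F$ is stem-Nash on $D$ if for some $I$ and some splitting base associated to $I$ all $F^{\ell}_{I,I_k}$ are complex Nash on $D$. $f=\mathcal{I}(F)$ is slice-Nash on $\Omega_D$ if it is slice regular and $F$ is stem-Nash on $D$. *)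

(* Defs.v *)
From HB Require Import structures.
From mathcomp Require Import all_boot all_order all_algebra complex polyXY.
From mathcomp Require Import all_classical all_reals all_analysis.
Import Order.TTheory GRing.Theory Num.Theory.
Import numFieldNormedType.Exports.

Set Implicit Arguments.
Unset Strict Implicit.
Unset Printing Implicit Defensive.

Local Open Scope classical_set_scope.
Local Open Scope ring_scope.
Local Open Scope complex_scope.

(* Cayley-Dickson tower: level 2 is the quaternions, level 3 the octonions.
   The norm that [normedModType] puts on a product is the sup norm. Its
   topology is the Euclidean one, but the Euclidean norm of the algebra is
   [anorm] below. *)
Fixpoint cd (R : realType) (n : nat) : normedModType R :=
  if n is n'.+1 then (cd R n' * cd R n')%type else R^o.

Fixpoint cd1 (R : realType) (n : nat) : cd R n :=
  match n with 0 => 1 : R | n'.+1 => (cd1 R n', 0) end.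

Fixpoint cdconj (R : realType) (n : nat) : cd R n -> cd R n :=
  match n with
  | 0 => fun x => x
  | n'.+1 => fun x => (cdconj x.1, - x.2)
  end.

Fixpoint cdmul (R : realType) (n : nat) : cd R n -> cd R n -> cd R n :=
  match n with
  | 0 => fun x y => (x : R) * (y : R)
  | n'.+1 => fun x y =>
      (cdmul x.1 y.1 - cdmul (cdconj y.2) x.2,
       cdmul y.2 x.1 + cdmul x.2 (cdconj y.1))
  end.

Fixpoint cdre (R : realType) (n : nat) : cd R n -> R :=
  match n with 0 => fun x => x | n'.+1 => fun x => cdre x.1 end.

Variant division_algebra := Quaternions | Octonions.

Definition cd_level (A : division_algebra) : nat :=
  match A with Quaternions => 2 | Octonions => 3 end.

Definition udim (A : division_algebra) : nat :=
  match A with Quaternions => 1 | Octonions => 3 end.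

Notation alg R A := (cd R (cd_level A)).

(* The complex field, seen as a normed space over itself. *)
Notation Cplx R := (R[i]^o).

Section Algebra.
Variables (R : realType) (A : division_algebra).
Implicit Types (x y I : alg R A) (D : set (Cplx R)) (Omega : set (alg R A)).

Definition amul x y : alg R A := cdmul x y.
Definition aone : alg R A := cd1 R (cd_level A).
(* x x^c is a real multiple of the unit, so [cdre] loses nothing. *)
Definition anorm x : R := Num.sqrt (cdre (amul x (cdconj x))).

Definition imag_units : set (alg R A) := [set I | amul I I = - aone].

Definition slice_point I (a b : R) : alg R A := a *: aone + b *: I.

Definition conj_invariant D := forall z : R[i], D z -> D z^*.

Definition circularization D : set (alg R A) :=
  [set x | exists (z : R[i]) (I : alg R A),
     [/\ D z, imag_units I & x = slice_point I (complex.Re z) (complex.Im z)]].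

Definition circular Omega :=
  exists D, conj_invariant D /\ Omega = circularization D.

Definition circular_domain Omega :=
  [/\ open Omega, connected Omega & circular Omega].

Definition aunbounded Omega := forall M : R, exists2 x, Omega x & M < anorm x.

(* A (x) C: the pair (x, y) stands for x + iota y. *)
Definition tensorC : normedModType R := (alg R A * alg R A)%type.
Definition tensorC_conj (w : tensorC) : tensorC := (w.1, - w.2).
Definition tensorC_iota (w : tensorC) : tensorC := (- w.2, w.1).

Implicit Type F : Cplx R -> tensorC.

Definition stem_function D F :=
  [/\ open D, conj_invariant D
    & forall z : R[i], D z -> F z^* = tensorC_conj (F z)].

Definition induces D F (f : alg R A -> alg R A) :=
  forall (z : R[i]) I, D z -> imag_units I ->
    f (slice_point I (complex.Re z) (complex.Im z)) =
      (F z).1 + amul I (F z).2.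

Definition along_re F (z : R[i]) : R -> tensorC :=
  fun a => F (a +i* complex.Im z).
Definition along_im F (z : R[i]) : R -> tensorC :=
  fun b => F (complex.Re z +i* b).

Definition d_alpha F : Cplx R -> tensorC :=
  fun z => derive1 (along_re F z) (complex.Re z).
Definition d_beta F : Cplx R -> tensorC :=
  fun z => derive1 (along_im F z) (complex.Im z).

Definition stem_C1 D F :=
  forall z : Cplx R, D z ->
    [/\ derivable (along_re F z) (complex.Re z) 1,
        derivable (along_im F z) (complex.Im z) 1,
        {for z, continuous (d_alpha F)}
      & {for z, continuous (d_beta F)}].

Definition stem_holomorphic D F :=
  stem_C1 D F /\
  forall z : Cplx R, D z -> d_alpha F z + tensorC_iota (d_beta F z) = 0.

Definition complex_nash D (g : Cplx R -> Cplx R) :=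
  forall z, D z -> exists U : set (Cplx R),
    [/\ open U, U z, U `<=` D,
        forall w, U w -> derivable g w 1
      & exists2 P : {poly {poly R[i]}}, P != 0 &
          forall w, U w -> P.[w, g w] = 0].

(* [J] lists I_0 = 1, I_1, ..., I_u; it is a base of the left C_I-vector
   space A. *)
Definition splitting_base I (J : 'I_(udim A).+1 -> alg R A) :=
  [/\ J ord0 = aone,
      forall x, exists a b : 'I_(udim A).+1 -> R,
        x = \sum_k amul (slice_point I (a k) (b k)) (J k)
    & forall a b : 'I_(udim A).+1 -> R,
        \sum_k amul (slice_point I (a k) (b k)) (J k) = 0 ->
        forall k, a k = 0 /\ b k = 0].

(* [G1 k] and [G2 k] are the functions F^1_{I,I_k} and F^2_{I,I_k}: the real
   parts are the coordinates of F_1 and the imaginary parts those of F_2. *)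
Definition splitting_components D F I (J : 'I_(udim A).+1 -> alg R A)
    (G1 G2 : 'I_(udim A).+1 -> Cplx R -> Cplx R) :=
  forall z, D z ->
    (F z).1 = \sum_k amul
      (slice_point I (complex.Re (G1 k z)) (complex.Re (G2 k z))) (J k) /\
    (F z).2 = \sum_k amul
      (slice_point I (complex.Im (G1 k z)) (complex.Im (G2 k z))) (J k).

Definition stem_nash D F :=
  exists I (J : 'I_(udim A).+1 -> alg R A),
    [/\ imag_units I, splitting_base I J
      & exists G1 G2 : 'I_(udim A).+1 -> Cplx R -> Cplx R,
          splitting_components D F I J G1 G2 /\
          forall k, complex_nash D (G1 k) /\ complex_nash D (G2 k)].

(* Only the values of [f] on [Omega] matter. *)
Definition slice_nash Omega (f : alg R A -> alg R A) :=
  exists D F,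
    [/\ Omega = circularization D, stem_function D F, induces D F f,
        stem_holomorphic D F & stem_nash D F].

End Algebra.

(* Main.v *)
(* Each component g of the stem function is locally algebraic over C(z). If P is
   a polynomial with P(z, g z) = 0 near some point, the same equation persists
   along every connected subset of D: on a small ball g also satisfies some
   Q(z, g z) = 0, and Q divides r P^N B where P and B are coprime over C(z), so
   off the finitely many zeros of a resultant r(z) exactly one of P(z, g z) and
   B(z, g z) vanishes; continuity along segments avoiding those zeros excludes a
   switch, and no identity theorem for holomorphic functions is needed. The
   image of Omega in the closed upper half plane under a + b I |-> a + iota |b|
   is connected, so a single equation governs g there, and Cauchy's bound on the
   roots of a polynomial in terms of its coefficients gives polynomial growth. *)
Require Import Defs.
From mathcomp Require Import all_boot all_order all_algebra.
From mathcomp Require Import all_classical all_reals all_analysis.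
From mathcomp Require Import complex polyXY ring lra.
Import Order.TTheory GRing.Theory Num.Theory.
Import numFieldNormedType.Exports.
Local Open Scope ring_scope.

(** * Cayley-Dickson algebras: bilinearity, squared norm, imaginary units *)

Section CayleyDickson.
#[local] Set Implicit Arguments.
#[local] Unset Strict Implicit.
Context {R : realType}.

(* Unlike [.1] and [.2], these projections keep [cd R n] folded in their type. *)
Definition cdl n (x : cd R n.+1) : cd R n := x.1.
Definition cdr n (x : cd R n.+1) : cd R n := x.2.

Lemma cd_ext n (x y : cd R n.+1) : cdl x = cdl y -> cdr x = cdr y -> x = y.
Proof. by case: x y => [? ?] [? ?]; rewrite /cdl /cdr /= => -> ->. Qed.

Local Lemma cdlD n (x y : cd R n.+1) : cdl (x + y) = cdl x + cdl y. Proof. by []. Qed.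
Local Lemma cdrD n (x y : cd R n.+1) : cdr (x + y) = cdr x + cdr y. Proof. by []. Qed.
Local Lemma cdlN n (x : cd R n.+1) : cdl (- x) = - cdl x. Proof. by []. Qed.
Local Lemma cdrN n (x : cd R n.+1) : cdr (- x) = - cdr x. Proof. by []. Qed.
Local Lemma cdlZ n a (x : cd R n.+1) : cdl (a *: x) = a *: cdl x. Proof. by []. Qed.
Local Lemma cdrZ n a (x : cd R n.+1) : cdr (a *: x) = a *: cdr x. Proof. by []. Qed.
Local Lemma cdl1 n : cdl (cd1 R n.+1) = cd1 R n. Proof. by []. Qed.
Local Lemma cdr1 n : cdr (cd1 R n.+1) = 0. Proof. by []. Qed.
Local Lemma cdl_conj n (x : cd R n.+1) : cdl (cdconj x) = cdconj (cdl x).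
Proof. by []. Qed.
Local Lemma cdr_conj n (x : cd R n.+1) : cdr (cdconj x) = - cdr x. Proof. by []. Qed.
Local Lemma cdl_mul n (x y : cd R n.+1) :
  cdl (cdmul x y) = cdmul (cdl x) (cdl y) - cdmul (cdconj (cdr y)) (cdr x).
Proof. by []. Qed.
Local Lemma cdr_mul n (x y : cd R n.+1) :
  cdr (cdmul x y) = cdmul (cdr y) (cdl x) + cdmul (cdr x) (cdconj (cdl y)).
Proof. by []. Qed.
Local Lemma cdreS n (x : cd R n.+1) : cdre x = cdre (cdl x). Proof. by []. Qed.
Local Definition cd_unfold := (cdlD, cdrD, cdlN, cdrN, cdlZ, cdrZ, cdl1, cdr1, cdl_conj,
  cdr_conj, cdl_mul, cdr_mul, cdreS).

Lemma cdconjD n (x y : cd R n) : cdconj (x + y) = cdconj x + cdconj y.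
Proof.
by elim: n x y => [//|n IH] x y; apply: cd_ext; rewrite !cd_unfold ?IH ?opprD.
Qed.

Lemma cdconjZ n (a : R) (x : cd R n) : cdconj (a *: x) = a *: cdconj x.
Proof.
by elim: n x => [//|n IH] x; apply: cd_ext; rewrite !cd_unfold ?IH -?scalerN.
Qed.

Lemma cdmulD n :
  (forall x y z : cd R n, cdmul (x + y) z = cdmul x z + cdmul y z) /\
  (forall x y z : cd R n, cdmul x (y + z) = cdmul x y + cdmul x z).
Proof.
elim: n => [|n [IHl IHr]]; first by split=> x y z /=; rewrite ?mulrDl ?mulrDr.
split=> x y z; apply: cd_ext;
  rewrite !cd_unfold ?cdconjD !(IHl, IHr) ?opprD;
  exact: addrACA.
Qed.

Lemma cdmulZ n (a : R) :
  (forall x y : cd R n, cdmul (a *: x) y = a *: cdmul x y) /\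
  (forall x y : cd R n, cdmul x (a *: y) = a *: cdmul x y).
Proof.
elim: n => [|n [IHl IHr]].
  by split=> x y; [exact: esym (mulrA _ _ _) | exact: mulrCA].
by split=> x y; apply: cd_ext; rewrite !cd_unfold ?cdconjZ !(IHl, IHr)
  ?scalerBr ?scalerDr.
Qed.

Lemma cdmulNl n (x y : cd R n) : cdmul (- x) y = - cdmul x y.
Proof. by rewrite -scaleN1r (cdmulZ n _).1 scaleN1r. Qed.

Lemma cdmulNr n (x y : cd R n) : cdmul x (- y) = - cdmul x y.
Proof. by rewrite -scaleN1r (cdmulZ n _).2 scaleN1r. Qed.

Lemma cdmul0l n (x : cd R n) : cdmul 0 x = 0.
Proof. by rewrite -[X in cdmul X _](scale0r 0) (cdmulZ n 0).1 scale0r. Qed.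

Lemma cdmul0r n (x : cd R n) : cdmul x 0 = 0.
Proof. by rewrite -[X in cdmul _ X](scale0r 0) (cdmulZ n 0).2 scale0r. Qed.

Lemma cdconj0 n : cdconj (0 : cd R n) = 0.
Proof. by rewrite -[X in cdconj X](scale0r 0) cdconjZ scale0r. Qed.

Lemma cdconj1 n : cdconj (cd1 R n) = cd1 R n.
Proof.
by elim: n => [//|n IH]; apply: cd_ext; rewrite !cd_unfold ?oppr0.
Qed.

Lemma cdmulx1 n (x : cd R n) : cdmul x (cd1 R n) = x.
Proof.
elim: n x => [|n IH] x; first exact: mulr1.
apply: cd_ext; rewrite !cd_unfold ?cdconj0 ?cdconj1 IH.
  by rewrite cdmul0l subr0.
by rewrite cdmul0l add0r.
Qed.

Lemma cdmul1x n (x : cd R n) : cdmul (cd1 R n) x = x.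
Proof.
elim: n x => [|n IH] x; first exact: mul1r.
apply: cd_ext; rewrite !cd_unfold.
  by rewrite cdmul0r IH subr0.
by rewrite cdmul0l cdmulx1 addr0.
Qed.

(** The squared Euclidean norm as a sum of squares of real coordinates, a form in which positivity
    and continuity are plain inductions; [cdre_mul_conj] links it to [anorm]. *)
Fixpoint cdsq n : cd R n -> R :=
  match n return cd R n -> R with
  | 0 => fun x : R => x ^+ 2
  | n'.+1 => fun x => cdsq (cdl x) + cdsq (cdr x)
  end.
Arguments cdsq {n}.

Lemma cdsqS n (x : cd R n.+1) : cdsq x = cdsq (cdl x) + cdsq (cdr x).
Proof. by []. Qed.

Lemma cdreD n (x y : cd R n) : cdre (x + y) = cdre x + cdre y.
Proof. by elim: n x y => [//|n IH] x y; rewrite !cd_unfold IH. Qed.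

Lemma cdreZ n (a : R) (x : cd R n) : cdre (a *: x) = a * cdre x.
Proof. by elim: n x => [//|n IH] x; rewrite !cd_unfold IH. Qed.

Lemma cdre1 n : cdre (cd1 R n) = 1.
Proof. by elim: n => [//|n IH]; rewrite !cd_unfold. Qed.

Lemma cdsq_ge0 n (x : cd R n) : 0 <= cdsq x.
Proof.
by elim: n x => [|n IH] x; [exact: sqr_ge0 | rewrite cdsqS addr_ge0].
Qed.

(** With the conjugate on the left, both terms of the first component are again a conjugate times
    its element, and the two terms of the second cancel literally. *)
Lemma cdconj_mul n (x : cd R n) : cdmul (cdconj x) x = cdsq x *: cd1 R n.
Proof.
elim: n x => [|n IH] x; first exact: esym (mulr1 _).
apply: cd_ext; rewrite !cd_unfold.
  by rewrite cdmulNr opprK !IH -scalerDl.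
by rewrite cdmulNl subrr scaler0.
Qed.

Lemma cd_conj_re n (x : cd R n) : x + cdconj x = (2 * cdre x) *: cd1 R n.
Proof.
elim: n x => [|n IH] x.
  have e (y : R) : y + y = 2 * y * 1 by ring.
  exact: e.
by apply: cd_ext; rewrite !cd_unfold ?IH // scaler0 subrr.
Qed.

(** The conjugate is a real multiple of the unit minus [x], so it commutes with [x]; this transfers
    [cdconj_mul] to the order used in [anorm]. *)
Lemma cdre_mul_conj n (x : cd R n) : cdre (cdmul x (cdconj x)) = cdsq x.
Proof.
have -> : cdmul x (cdconj x) = cdmul (cdconj x) x.
  have e : cdconj x = (2 * cdre x) *: cd1 R n - x by rewrite -cd_conj_re addrC addKr.
  rewrite [in RHS]e [in LHS]e (cdmulD n).1 (cdmulD n).2 cdmulNl cdmulNr.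
  by rewrite (cdmulZ n _).1 (cdmulZ n _).2 cdmulx1 cdmul1x.
by rewrite cdconj_mul cdreZ cdre1 mulr1.
Qed.

(** Multiply [x + cdconj x], which is real, by [x] on the right. *)
Lemma cd_sqr n (x : cd R n) :
  cdmul x x = (2 * cdre x) *: x - cdsq x *: cd1 R n.
Proof.
rewrite -cdconj_mul; apply/eqP; rewrite eq_sym subr_eq -(cdmulD n).1; apply/eqP.
by rewrite cd_conj_re (cdmulZ n _).1 cdmul1x.
Qed.

Lemma cd1_inj n (a b : R) : a *: cd1 R n = b *: cd1 R n -> a = b.
Proof. by move=> /(congr1 (@cdre R n)); rewrite !cdreZ cdre1 !mulr1. Qed.

(* The square of [x] is [2 re(x) x - |x|^2], so a non-zero real part would make
   an imaginary unit real. *)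
Lemma cd_imag_unit n (x : cd R n) :
  cdmul x x = - cd1 R n -> cdre x = 0 /\ cdsq x = 1.
Proof.
rewrite cd_sqr => e.
have e2 : (2 * cdre x) *: x = (cdsq x - 1) *: cd1 R n.
  by rewrite scalerBl scale1r -e addrC subrK.
have [r0|r0] := eqVneq (cdre x) 0.
  split=> //; move: e2; rewrite r0 mulr0 scale0r -(scale0r (cd1 R n)).
  by move/cd1_inj/esym/eqP; rewrite subr_eq0 => /eqP.
set c := cdsq x - 1 in e2.
have xr : x = (c / (2 * cdre x)) *: cd1 R n.
  by rewrite mulrC -scalerA -e2 scalerA mulVf ?scale1r // mulf_neq0.
move: e; rewrite -cd_sqr {}xr (cdmulZ n _).1 (cdmulZ n _).2 cdmulx1 scalerA.
rewrite -(scaleN1r (cd1 R n)) => /cd1_inj e.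
by have := sqr_ge0 (c / (2 * cdre x)); rewrite expr2 e oppr_ge0 ler10.
Qed.

Lemma cdsqZ n (a : R) (x : cd R n) : cdsq (a *: x) = a ^+ 2 * cdsq x.
Proof.
elim: n x => [|n IH] x; first exact: exprMn.
by rewrite !cdsqS !cd_unfold !IH mulrDr.
Qed.

Lemma cdsq_slice n (a b : R) (x : cd R n) :
  cdsq (a *: cd1 R n + b *: x) = a ^+ 2 + 2 * a * b * cdre x + b ^+ 2 * cdsq x.
Proof.
elim: n x => [|n IH] x.
  have e (y : R) : (a * 1 + b * y) ^+ 2 = a ^+ 2 + 2 * a * b * y + b ^+ 2 * y ^+ 2.
    by ring.
  exact: e.
by rewrite !cdsqS !cd_unfold IH scaler0 add0r cdsqZ; ring.
Qed.

(** * Sup norm against Euclidean norm, and continuity *)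

Lemma cd_normE n (x : cd R n.+1) : `|x| = Num.max `|cdl x| `|cdr x|.
Proof. by []. Qed.

Lemma cd_norm_conj n (x : cd R n) : `|cdconj x| = `|x|.
Proof.
elim: n x => [//|n IH] x; rewrite !cd_normE /= normrN; congr Num.max; exact: IH.
Qed.

(** Each component of a product is a sum or difference of two products one level down, so the
    constant for the sup norm doubles with the level. *)
Lemma cd_norm_mul n (x y : cd R n) : `|cdmul x y| <= 2 ^+ n * `|x| * `|y|.
Proof.
elim: n x y => [|n IH] x y.
  have e (u v : R) : `|u * v| <= 2 ^+ 0 * `|u| * `|v| by rewrite mul1r normrM.
  exact: e.
have h (u v u' v' : cd R n) : `|u| <= `|x| -> `|v| <= `|y| ->
    `|u'| <= `|x| -> `|v'| <= `|y| ->
    2 ^+ n * `|u| * `|v| + 2 ^+ n * `|u'| * `|v'| <= 2 ^+ n.+1 * `|x| * `|y|.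
  move=> h1 h2 h3 h4; rewrite exprS -!mulrA mulr2n mulrDl mul1r.
  have p : 0 <= 2 ^+ n :> R by apply: exprn_ge0.
  by apply: lerD; apply: ler_wpM2l => //; apply: ler_pM.
have hx1 : `|cdl x| <= `|x| by rewrite cd_normE le_max lexx.
have hx2 : `|cdr x| <= `|x| by rewrite cd_normE le_max lexx orbT.
have hy1 : `|cdl y| <= `|y| by rewrite cd_normE le_max lexx.
have hy2 : `|cdr y| <= `|y| by rewrite cd_normE le_max lexx orbT.
rewrite cd_normE ge_max; apply/andP; split => /=.
  apply: le_trans (ler_normB _ _) _.
  have := h _ _ _ _ hx1 hy1 hx2 hy2; apply: le_trans; apply: lerD; first exact: IH.
  by apply: le_trans (IH _ _) _; rewrite cd_norm_conj mulrAC.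
apply: le_trans (ler_normD _ _) _.
have := h _ _ _ _ hx1 hy2 hx2 hy1; apply: le_trans; apply: lerD.
  by apply: le_trans (IH _ _) _; rewrite mulrAC.
by apply: le_trans (IH _ _) _; rewrite cd_norm_conj.
Qed.

Lemma cdsq_le n (x : cd R n) : cdsq x <= 2 ^+ n * `|x| ^+ 2.
Proof.
elim: n x => [|n IH] x /=; first by rewrite mul1r real_normK // num_real.
rewrite exprS -mulrA mulr2n mulrDl mul1r.
have p : 0 <= 2 ^+ n :> R by apply: exprn_ge0.
apply: lerD; apply: le_trans (IH _) _; apply: ler_wpM2l => //;
  by apply: lerXn2r; rewrite ?nnegrE // [leRHS]cd_normE le_max lexx ?orbT.
Qed.

Lemma le_cdsq n (x : cd R n) : `|x| ^+ 2 <= cdsq x.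
Proof.
elim: n x => [|n IH] x /=; first by rewrite real_normK // num_real.
rewrite [`|x|]cd_normE maxEle; case: ifP => _.
  by apply: le_trans (IH _) _; rewrite lerDr cdsq_ge0.
by apply: le_trans (IH _) _; rewrite lerDl cdsq_ge0.
Qed.

Lemma cdre_continuous n : continuous (@cdre R n).
Proof.
elim: n => [|n IH] x /=; first exact: cvg_id.
by apply: (continuous_comp _ (IH (cdl x))) => /=; exact: cvg_fst.
Qed.

Lemma cdsq_continuous n : continuous (@cdsq n).
Proof.
elim: n => [|n IH] x /=; first exact: exprn_continuous.
apply: cvgD.
  by apply: (continuous_comp _ (IH (cdl x))) => /=; exact: cvg_fst.
by apply: (continuous_comp _ (IH (cdr x))) => /=; exact: cvg_snd.
Qed.

End CayleyDickson.
Arguments cdsq {R n}.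

(** * Bivariate polynomials: splitting off common factors *)

Section Polynomials.
#[local] Set Implicit Arguments.
#[local] Unset Strict Implicit.
Import Pdiv.Idomain.

(** Divide [Q] by its gcd with [P] until the quotient is coprime to [P]; the size drops each time
    and [N] counts the divisions. *)
Lemma dvdp_coprime_part (S : idomainType) (P Q : {poly S}) : Q != 0 ->
  exists (N : nat) (B : {poly S}), coprimep P B && (Q %| P ^+ N * B).
Proof.
have [n] := ubnP (size Q); elim: n Q => [//|n IH] Q sQ Q0.
have [cPQ|nPQ] := boolP (coprimep P Q).
  by exists 0, Q; rewrite cPQ expr0 mul1r dvdpp.
(* Divisibility over a domain holds only up to a nonzero scalar, here [c]. *)
have /dvdpP[[c Q'] /= c0 eQ] := dvdp_gcdr P Q.
have cQ0 : c *: Q != 0 by rewrite -size_poly_eq0 size_scale // size_poly_eq0.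
have Q'0 : Q' != 0 by apply: contraNneq cQ0 => Q'0; rewrite eQ Q'0 mul0r.
have G0 : gcdp P Q != 0 by rewrite gcdp_eq0 negb_and Q0 orbT.
have sG : (1 < size (gcdp P Q))%N.
  by rewrite ltn_neqAle eq_sym -coprimep_def nPQ size_poly_gt0.
have sQ' : (size Q' < n)%N.
  have := size_mul Q'0 G0; rewrite -eQ size_scale // => e.
  by move: sQ; rewrite e; move: sG; case: (size (gcdp P Q)) => [|[|k]] // _;
    rewrite !addnS /= ltnS; apply: leq_ltn_trans; rewrite leq_addr.
have [N [B /andP[cB dB]]] := IH _ sQ' Q'0.
exists N.+1, B; rewrite cB -(dvdpZl _ _ c0) eQ exprSr mulrAC.
by rewrite dvdp_mul // dvdp_gcdl.
Qed.

(* Over the fraction field of [S], [Q] divides a power of [P] times a part [B]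
   coprime to [P]; the factor [r] clears the denominators. *)
Lemma separate_common_factor (S : idomainType) (P Q : {poly S}) : Q != 0 ->
  exists (r : S) (N : nat) (B u v s : {poly S}),
    [/\ r != 0, r%:P = u * P + v * B & r%:P * (P ^+ N * B) = s * Q].
Proof.
move=> Q0; have [N [B /andP[cB /dvdpP[[c s] /= c0 es]]]] := dvdp_coprime_part P Q0.
have /Bezout_coprimepP[[u v] /eqpP[[c1 c2] /= /andP[c10 c20] e]] := cB.
exists (c * c2), N, B, (c *: (c1 *: u)), (c *: (c1 *: v)), (c2 *: s).
split; first by rewrite mulf_neq0.
  rewrite -!scalerAl -!scalerDr e -!mul_polyC mulr1 polyCM //.
by rewrite -scalerAl -es !mul_polyC scalerA mulrC.
Qed.

(** Evaluate both identities of [separate_common_factor]: the divisibility makes [P] or [B] vanish,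
    and the Bezout relation forbids both, since its left side is [r.[x]]. *)
Lemma separate_zeros (K : fieldType) (P Q : {poly {poly K}}) : Q != 0 ->
  exists (r : {poly K}) (B : {poly {poly K}}), r != 0 /\
    forall x t : K, r.[x] != 0 -> Q.[t, x] = 0 ->
      P.[t, x] * B.[t, x] = 0 /\ ~ (P.[t, x] = 0 /\ B.[t, x] = 0).
Proof.
move=> Q0; have [r [N [B [u [v [s [r0 er es]]]]]]] := separate_common_factor P Q0.
exists r, B; split=> // x t rx Qx; split=> [|[Px Bx]].
  have /(congr1 (fun S => S.[t, x]))/eqP := es.
  rewrite !hornerE Qx mulr0 !mulf_eq0 (negPf rx) expf_eq0 /=.
  by move=> /orP[/andP[_]|] /eqP ->; rewrite ?mul0r ?mulr0.
have /(congr1 (fun S => S.[t, x])) := er.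
by rewrite !hornerE Px Bx !mulr0 addr0 => /eqP; apply/negP.
Qed.

End Polynomials.

(** * Continuity of polynomial evaluation *)

Lemma horner_continuous (K : numFieldType) (p : {poly K}) (w : K) :
  {for w, continuous (horner p : K -> K)}.
Proof.
elim/poly_ind: p => [|p c IH].
  rewrite (_ : horner _ = (fun=> 0)); first exact: cst_continuous.
  by apply/funext => x; rewrite !horner0.
rewrite (_ : horner _ = (fun x : K => p.[x] * x + c)).
  apply: (@continuousD K K); last exact: cst_continuous.
  by apply: (@continuousM K K).
by apply/funext => x; rewrite !hornerE.
Qed.

Lemma horner2_continuous (K : numFieldType) (P : {poly {poly K}}) (g : K -> K)
    (w : K) : {for w, continuous g} ->
  {for w, continuous (fun x : K => P.[g x, x])}.
Proof.
move=> gc; elim/poly_ind: P => [|P c IH].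
  rewrite (_ : (fun _ => _) = (fun=> 0)); first exact: cst_continuous.
  by apply/funext => x; rewrite !horner0.
rewrite (_ : (fun _ => _) = (fun x : K => P.[(g x)%:P].[x] * g x + c.[x])).
  by apply: (@continuousD K K); [exact: (@continuousM K K) | exact: horner_continuous].
by apply/funext => x; rewrite !hornerE.
Qed.

(** * Continuation of a polynomial equation along connected sets *)

Section Continuation.
#[local] Set Implicit Arguments.
#[local] Unset Strict Implicit.
Import Normc.
Context {R : realType}.
Local Notation C := (Cplx R).
Implicit Types (P Q : {poly {poly R[i]}}) (g : C -> C).

(** The norm of [Cplx R] takes values in [R[i]]; the real-valued [normc] is what estimates and the
    intermediate value theorem require. *)
Lemma normE (z : C) : `|z| = (normc z)%:C%C.
Proof. by case: z. Qed.

Lemma normc_real (s : R) : normc (s%:C)%C = `|s|.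
Proof. by rewrite /= expr0n addr0 sqrtr_sqr. Qed.

Lemma normc_ge0 (z : R[i]) : 0 <= normc z.
Proof. by case: z => a b; exact: sqrtr_ge0. Qed.

Lemma nbhs_normc_ball (U : set C) (z : C) : nbhs z U ->
  exists2 e : R, 0 < e & forall w : C, normc (z - w) < e -> U w.
Proof.
move=> /nbhs_ballP[[a b] /=]; rewrite ltcE /= => /andP[/eqP -> a0] eU.
exists a => // w zw; apply: eU.
by rewrite -ball_normE /= normE (ltcR (normc (z - w)) a).
Qed.

Lemma normc_ball_nbhs (z : C) (e : R) : 0 < e ->
  nbhs z [set w | normc (z - w) < e]%classic.
Proof.
move=> e0; apply/nbhs_ballP; exists (e%:C)%C; first by rewrite /= ltcR.
by move=> w; rewrite -ball_normE /= normE ltcR.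
Qed.

Lemma normc_continuous : continuous (@normc R : C -> R).
Proof.
move=> z; apply/(@cvgrPdist_lt R R^o C (nbhs (z : C)) (nbhs_filter (z : C))) => e e0.
apply: filterS (normc_ball_nbhs z e0) => w /= zw; apply: le_lt_trans zw.
have h (a b : R[i]) : normc a - normc b <= normc (a - b).
  by rewrite lerBlDr; apply: le_trans (le_normcD _ _); rewrite subrK.
by rewrite ler_norml h andbT lerNl opprB (le_trans (h _ _)) // -normcN opprB.
Qed.

Lemma avoid_seq (s : seq R) (e : R) : 0 < e ->
  exists t : R, [/\ 0 < t, t < e & t \notin s].
Proof.
(* Strengthened to a whole interval free of [s], which the induction only has to shrink. *)
move=> e0; suff [d [d0 de ds]] : exists d, [/\ 0 < d, d <= e &
    forall t, 0 < t -> t < d -> t \notin s].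
  by exists (d / 2); split; [lra | lra | apply: ds; lra].
elim: s => [|a s [d [d0 de ds]]]; first by exists e.
have [a0|a0] := ltP 0 a; last first.
  exists d; split=> // t t0 td; rewrite inE negb_or ds // andbT.
  by rewrite gt_eqF // (le_lt_trans a0).
exists (Num.min a d); split; rewrite ?lt_min ?a0 ?ge_min ?de ?orbT //.
move=> t t0; rewrite lt_min => /andP[ta td]; rewrite inE negb_or ds // andbT.
by rewrite lt_eqF.
Qed.

Lemma poly_roots_seq (r : {poly R[i]}) : r != 0 ->
  exists s : seq R[i], forall z, root r z = (z \in s).
Proof.
move=> r0; have [s es] := closed_field_poly_normal r; exists s => z.
by rewrite es rootZ ?lead_coef_eq0 // root_prod_XsubC.
Qed.

Lemma real_complex_continuous : continuous (fun t : R => (t%:C)%C : C).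
Proof.
move=> t; apply/(@cvgrPdist_lt _ C R (nbhs (t : R)) (nbhs_filter (t : R))).
move=> [a b]; rewrite ltcE /= => /andP[/eqP -> a0].
have := nbhsx_ballx (t : R) a a0; apply: filterS => s; rewrite -ball_normE /=.
by rewrite normE -rmorphB /= expr0n /= addr0 sqrtr_sqr ltcR.
Qed.

Definition segment (a b : C) (t : R) : C := a + (t%:C)%C * (b - a).

Lemma segment_continuous (a b : C) (t : R) : {for t, continuous (segment a b)}.
Proof.
apply: (@continuousD R[i] C R); first exact: cst_continuous.
apply: (@continuousM R[i] R); last exact: cst_continuous.
exact: real_complex_continuous.
Qed.

Lemma normc_segment (z a b : C) (t e : R) : 0 <= t <= 1 ->
  normc (z - a) < e -> normc (z - b) < e -> normc (z - segment a b t) < e.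
Proof.
move=> /andP[t0 t1] ae be.
have -> : z - segment a b t =
    ((1 - t)%:C)%C * (z - a : R[i]) + (t%:C)%C * (z - b : R[i]).
  by rewrite /segment rmorphB rmorph1; ring.
apply: le_lt_trans (le_normcD _ _) _; rewrite !normcM.
rewrite !normc_real !ger0_norm ?subr_ge0 //.
have [->|t0'] := eqVneq t 0; first by rewrite subr0 mul1r mul0r addr0.
have tp : 0 < t by rewrite lt_def t0' t0.
by nra.
Qed.

(* [|P| - |B|] would have to change sign without vanishing. *)
Lemma zero_along_segment P (B : {poly {poly R[i]}}) g (a b : C) :
  (forall t, 0 <= t <= 1 -> {for segment a b t, continuous g}) ->
  (forall t, 0 <= t <= 1 -> let w := segment a b t in
     P.[g w, w] * B.[g w, w] = 0 /\ ~ (P.[g w, w] = 0 /\ B.[g w, w] = 0)) ->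
  P.[g a, a] = 0 -> P.[g b, b] = 0.
Proof.
move=> gc PB Pa.
pose h (S : {poly {poly R[i]}}) (w : C) : R := normc S.[g w, w].
pose m t : R := h P (segment a b t) - h B (segment a b t).
have e0 : segment a b 0 = a by rewrite /segment rmorph0 mul0r addr0.
have e1 : segment a b 1 = b by rewrite /segment rmorph1 mul1r addrC subrK.
have mc : {within `[0, 1], continuous m}%classic.
  apply: continuous_in_subspaceT => t; rewrite inE /= in_itv /= => t01.
  have hc S : {for t, continuous (h S \o segment a b)}.
    apply: (@continuous_comp _ _ _ (segment a b)); first exact: segment_continuous.
    apply: (@continuous_comp _ _ _ (fun w : C => S.[g w, w] : C)).
      exact: (@horner2_continuous R[i] S g _ (gc t t01)).
    exact: normc_continuous.
  exact: (@continuousB R R^o R _ _ t (hc P) (hc B)).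
have PB1 := PB 1; have PB0 := PB 0; rewrite /= e0 e1 in PB0 PB1.
apply/eqP; apply/negPn/negP => Pb.
have Bb : B.[g b, b] = 0.
  have [] := PB1; first by rewrite ler01 lexx.
  by move=> /eqP; rewrite mulf_eq0 (negPf Pb) => /eqP.
have m0 : m 0 <= 0.
  by rewrite /m /h e0 Pa normc0 sub0r oppr_le0; exact: normc_ge0.
have m1 : 0 <= m 1.
  by rewrite /m /h e1 Bb normc0 subr0; exact: normc_ge0.
have [|t t01 mt] := @IVT R m 0 1 0 ler01 mc.
  by rewrite ge_min m0 /= le_max m1 orbT.
rewrite in_itv /= in t01.
have [/eqP + nPB] := PB t t01; set w := segment a b t in nPB *.
(* The product vanishes and the moduli agree, so both factors vanish at [w], which is excluded. *)
have nn : normc P.[g w, w] = normc B.[g w, w] by apply/eqP; rewrite -subr_eq0 -mt.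
rewrite mulf_eq0 => /orP[] /eqP e; apply: nPB; split => //; apply: eq0_normc.
  by rewrite -nn e normc0.
by rewrite nn e normc0.
Qed.

(* The segment to [w] starts at [w0 + i t (w0 - w)]: each root of [r] lies on such
   a segment for at most one value of [t], its [slope]. *)
Lemma nash_continuation_ball P Q g (z : C) (e : R) (w0 : C) (d : R) :
  Q != 0 ->
  (forall w : C, normc (z - w) < e -> {for w, continuous g}) ->
  (forall w : C, normc (z - w) < e -> Q.[g w, w] = 0) ->
  normc (z - w0) < e -> 0 < d ->
  (forall w : C, normc (w0 - w) < d -> P.[g w, w] = 0) ->
  forall w : C, normc (z - w) < e -> P.[g w, w] = 0.
Proof.
move=> Q0 gc gQ zw0 d0 gP.
have [r [B [r0 PB]]] := separate_zeros P Q0.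
have [F rF] := poly_roots_seq r0.
(* Points off the zeros of [r] come first; the zeros follow by continuity. *)
have regular (w : C) : normc (z - w) < e -> r.[w] != 0 -> P.[g w, w] = 0.
  move=> zw rw.
  have [->|w0w] := eqVneq w w0; first by apply: gP; rewrite subrr normc0.
  pose q : R[i] := (w0 : R[i]) - w.
  have q0 : q != 0 by rewrite subr_eq0 eq_sym.
  have nq : 0 < normc q.
    by rewrite lt_def normc_ge0 andbT; apply: contraNneq q0 => /eq0_normc ->.
  (* The point of parameter [k] on the segment is [w + (1 - k) (1 + i t) q], so its slope is [t]
     unless [k = 1]. *)
  pose slope (p : R[i]) :=
    complex.Im ((p - w) / q) / complex.Re ((p - w) / q).
  (* The start of the segment is at distance [t * normc q] from [w0]: below [d] the equation for [P]
     is known there, and the other bound keeps it in the ball about [z]. *)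
  have dl : 0 < Num.min d (e - normc ((z : R[i]) - w0)) / normc q.
    by rewrite divr_gt0 // lt_min d0 subr_gt0.
  have [t [t0 + tF]] := avoid_seq [seq slope p | p <- F] dl.
  rewrite ltr_pdivlMr // lt_min => /andP[td te].
  pose w' : R[i] := w0 + (t%:C)%C * 'i%C * q.
  have nw' : normc ((w0 : R[i]) - w') = t * normc q.
    rewrite /w' opprD addNKr normcN !normcM normc_real gtr0_norm //.
    by rewrite /= expr0n add0r expr1n sqrtr1 mulr1.
  have zw' : normc ((z : R[i]) - w') < e.
    have -> : (z : R[i]) - w' = (z - w0 : R[i]) + (w0 - w' : R[i]).
      by rewrite addrA subrK.
    by apply: le_lt_trans (le_normcD _ _) _; rewrite nw' addrC -ltrBrDr.
  have seg (k : R) : 0 <= k <= 1 -> normc (z - segment w' w k) < e.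
    by move=> k01; exact: normc_segment.
  apply: (@zero_along_segment P B g w' w) => [k k01|k k01 /=|].
  - by apply: gc; exact: seg.
  - apply: PB; last by apply: gQ; exact: seg.
    apply/negP => /eqP rk; have : root r (segment w' w k) by apply/eqP.
    rewrite rF => kF.
    have es' : segment w' w k - w = ((1 - k)%:C)%C * (1 + (t%:C)%C * 'i%C) * q.
      by rewrite /segment /w' rmorphB rmorph1 /q; ring.
    have [k1|k1] := eqVneq k 1.
      move: es'; rewrite k1 subrr rmorph0 !mul0r => /eqP; rewrite subr_eq0 => /eqP e'.
      by move: rk; rewrite k1 e' => /eqP; rewrite (negPf rw).
    move/negP: tF; apply; apply/mapP; exists (segment w' w k) => //.
    rewrite /slope es' mulfK //= ; simpc.
    by rewrite [X in X / _]mulrC mulfK // subr_eq0 eq_sym.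
  - by apply: gP; rewrite nw'.
(* A nonzero value at [w] would persist nearby, yet [w + t] is not a root of [r] for suitable small
   real [t], so [regular] gives the value zero there. *)
move=> w zw; apply/eqP/negPn/negP => Pw.
have cP := @horner2_continuous R[i] P g w (gc _ zw).
have nPw : 0 < normc (P.[g w, w] : R[i]).
  by rewrite lt_def normc_ge0 andbT; apply: contraNneq Pw => /eq0_normc ->.
have [d1 d10 Hd1] := nbhs_normc_ball (cP _ (normc_ball_nbhs _ nPw)).
have dl : 0 < Num.min d1 (e - normc (z - w)) by rewrite lt_min d10 subr_gt0.
have [t [t0 + tF]] := avoid_seq [seq complex.Re (p - w : R[i]) | p <- F] dl.
rewrite lt_min => /andP[td te].
pose w' : R[i] := (w : R[i]) + (t%:C)%C.
have nw' : normc ((w : R[i]) - w') = t.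
  by rewrite /w' opprD addNKr normcN normc_real gtr0_norm.
suff : P.[g w', w'] = 0.
  by move=> Pw'; have := Hd1 w'; rewrite nw' /= Pw' subr0 ltxx => /(_ td).
apply: regular.
  have -> : (z : R[i]) - w' = (z - w : R[i]) + (w - w' : R[i]).
    by rewrite addrA subrK.
  by apply: le_lt_trans (le_normcD _ _) _; rewrite nw' addrC -ltrBrDr.
apply/negP => rw'; have : w' \in F by rewrite -rF.
move=> w'F; move/negP: tF; apply; apply/mapP; exists w' => //.
by rewrite /w' addrAC subrr add0r.
Qed.

(** Take the equation valid near one point of [E]. The set of points near which it holds is open,
    and [nash_continuation_ball] makes it relatively closed in [E]. *)
Lemma nash_global_equation (D E : set C) (g : C -> C) :
  complex_nash D g -> (E `<=` D)%classic -> connected E ->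
  exists2 Q : {poly {poly R[i]}}, Q != 0 & forall z, E z -> Q.[g z, z] = 0.
Proof.
move=> gD ED Ec.
have local_eq z : D z -> exists e Q, [/\ 0 < e, Q != 0,
    forall w : C, normc (z - w) < e -> {for w, continuous g}
    & forall w : C, normc (z - w) < e -> (Q : {poly {poly R[i]}}).[g w, w] = 0].
  move=> /gD [U [oU Uz _ dU [P P0 PU]]].
  have [e e0 eU] := nbhs_normc_ball (open_nbhs_nbhs (conj oU Uz)).
  (* After the swap the outer variable stands for [g w] and the coefficients are polynomials in [w],
     as Cauchy's bound will need. *)
  exists e, (swapXY P); split; rewrite ?swapXY_eq0 // => w /eU Uw.
    by apply/differentiable_continuous/derivable1_diffP; exact: dU.
  by rewrite horner2_swapXY PU.
have [[z0 Ez0]|/set0P/negP] := pselect (E !=set0)%classic; last first.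
  by move=> /negPn/eqP ->; exists 1 => //; rewrite oner_neq0.
have [e0 [Q [e00 Q0 _ gQ]]] := local_eq _ (ED _ Ez0).
(* The interior is taken in the plane, since [E] may fail to be open. *)
pose S : set C := (interior [set w | Q.[g w, w] = 0])%classic.
exists Q => // z Ez.
suff : (E `&` S)%classic = E.
  by move=> ES; move: Ez; rewrite -{1}ES => -[_ /interior_subset].
apply: Ec.
- exists z0; split=> //.
  by apply: filterS (normc_ball_nbhs z0 e00) => w; exact: gQ.
- by exists S => //; exact: open_interior.
- exists (closure S); first exact: closed_closure.
  apply/seteqP; split=> [w [Ew Sw]|w [Ew clw]]; split => //.
    exact: subset_closure.
  (* A ball about the limit point [w] carries its own equation [Q'] and meets [S], so the equation
     [Q] spreads over the ball. *)
  have [e [Q' [e_gt0 Q'0 gc gQ']]] := local_eq _ (ED _ Ew).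
  have [w0 [Sw0 ww0]] := clw _ (normc_ball_nbhs w e_gt0).
  have [d d0 dS] := nbhs_normc_ball Sw0.
  apply: filterS (normc_ball_nbhs w e_gt0) => x.
  exact: (nash_continuation_ball Q'0 gc gQ' ww0 d0 dS).
Qed.

(** * Polynomial growth of algebraic functions *)

Lemma poly_upper_bound (p : {poly R[i]}) : exists (m : nat) (M : R),
  0 <= M /\ forall x, 1 <= normc x -> normc p.[x] <= M * normc x ^+ m.
Proof.
elim/poly_ind: p => [|p c [m [M [M0 pM]]]].
  by exists 0%N, 0; split=> // x _; rewrite horner0 normc0 mul0r.
exists m.+1, (M + normc c); split=> [|x x1]; first by rewrite addr_ge0 // normc_ge0.
rewrite !hornerE (le_trans (le_normcD _ _)) // mulrDl lerD //.
  by rewrite normcM exprSr mulrA ler_wpM2r ?normc_ge0 // pM.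
by rewrite ler_peMr ?normc_ge0 // exprn_ege1.
Qed.

Lemma coef_sum_upper_bound (Q : {poly {poly R[i]}}) (n : nat) :
  exists (m : nat) (M : R), 0 <= M /\ forall x, 1 <= normc x ->
    \sum_(j < n) normc (Q`_j).[x] <= M * normc x ^+ m.
Proof.
elim: n => [|n [m [M [M0 IH]]]].
  by exists 0%N, 0; split=> // x _; rewrite big_ord0 mul0r.
have [k [L [L0 QL]]] := poly_upper_bound (Q`_n).
exists (m + k)%N, (M + L); split=> [|x x1]; first exact: addr_ge0.
rewrite big_ord_recr /= mulrDl lerD //.
  by rewrite (le_trans (IH x x1)) // ler_wpM2l // ler_weXn2l // leq_addr.
by rewrite (le_trans (QL x x1)) // ler_wpM2l // ler_weXn2l // leq_addl.
Qed.

(** Split [p] into linear factors: far out each has modulus at least 1, which leaves the leading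
    coefficient as lower bound. *)
Lemma poly_lower_bound (p : {poly R[i]}) : p != 0 ->
  exists c r : R, [/\ 0 < c, 1 <= r
    & forall x, r <= normc x -> c <= normc p.[x]].
Proof.
move=> p0; have [s es] := closed_field_poly_normal p.
have [r [r1 rs]] : exists r : R, 1 <= r /\ forall x, r <= normc x ->
    1 <= normc (\prod_(z <- s) ('X - z%:P)).[x].
  elim: s {es} => [|z s [r [r1 IH]]].
    by exists 1; split=> // x _; rewrite big_nil hornerE /= expr1n expr0n addr0 sqrtr1.
  exists (r + normc z); split=> [|x rx]; first by rewrite (le_trans r1) // lerDl normc_ge0.
  rewrite big_cons !hornerE normcM -[1]mulr1 ler_pM //.
    have := le_normcD (x - z) z; rewrite subrK => h.
    by rewrite (le_trans r1) // -(lerD2r (normc z)) (le_trans rx).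
  by apply: IH; rewrite (le_trans _ rx) // lerDl normc_ge0.
exists (normc (lead_coef p)), r; split=> // [|x /rs h].
  rewrite lt_def normc_ge0 andbT; apply: contraNneq p0 => /eq0_normc /eqP.
  by rewrite lead_coef_eq0.
by rewrite {2}es hornerZ normcM ler_peMr // normc_ge0.
Qed.

Lemma normcX (x : R[i]) n : normc (x ^+ n) = normc x ^+ n.
Proof.
elim: n => [|n IH]; last by rewrite !exprS normcM IH.
by rewrite /= expr1n expr0n addr0 sqrtr1.
Qed.

Lemma normc_sum n (F : 'I_n -> R[i]) :
  normc (\sum_(i < n) F i) <= \sum_(i < n) normc (F i).
Proof.
elim/big_ind2 : _ => // [|x x' y y' h h']; first by rewrite normc0.
by rewrite (le_trans (le_normcD _ _)) // lerD.
Qed.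

Lemma algebraic_growth (Q : {poly {poly R[i]}}) : Q != 0 ->
  exists (m : nat) (M r : R), [/\ 0 <= M, 1 <= r
    & forall t x : R[i], r <= normc x -> Q.[t, x] = 0 ->
        normc t <= M * normc x ^+ m].
Proof.
move=> Q0; have [c [r [c0 r1 lc]]] : exists c r : R, [/\ 0 < c, 1 <= r
    & forall x, r <= normc x -> c <= normc (lead_coef Q).[x]].
  by apply: poly_lower_bound; rewrite lead_coef_eq0.
have [m [M [M0 QM]]] := coef_sum_upper_bound Q (size Q).-1.
(* The 1 covers [normc t <= 1]; beyond that, isolating the leading term and dividing by a power of
   [t] gives the Cauchy bound [M / c]. *)
exists m, (1 + M / c), r; split=> // [|t x rx Qtx].
  by rewrite addr_ge0 // divr_ge0 // ltW.
have x1 : 1 <= normc x := le_trans r1 rx.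
have xm1 : 1 <= normc x ^+ m by rewrite exprn_ege1.
have [t1|/ltW t1] := leP (normc t) 1.
  rewrite (le_trans t1) // (le_trans xm1) // ler_peMl ?(le_trans ler01 xm1) //.
  by rewrite lerDl divr_ge0 // ltW.
rewrite mulrDl mul1r (@le_trans _ _ (M / c * normc x ^+ m)) //; last first.
  by rewrite lerDr (le_trans ler01).
rewrite mulrAC ler_pdivlMr //; apply: le_trans (QM x x1).
have sQ : (size Q).-1.+1 = size Q by rewrite prednK // size_poly_gt0.
have key : normc (lead_coef Q).[x] * normc t ^+ (size Q).-1 <=
    \sum_(j < (size Q).-1) normc (Q`_j).[x] * normc t ^+ j.
  have eQ : Q.[t%:P] = \sum_(j < (size Q).-1) Q`_j * t%:P ^+ j
      + lead_coef Q * t%:P ^+ (size Q).-1.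
    by rewrite horner_coef lead_coefE; case: (size Q) sQ => // n _; rewrite big_ord_recr.
  move: Qtx; rewrite eQ hornerD horner_sum.
  move=> /eqP; rewrite addrC addr_eq0 => /eqP; rewrite !hornerE => e.
  have := congr1 (@normc R) e; rewrite normcN normcM normcX => ->.
  rewrite (le_trans (normc_sum _)) // ler_sum // => j _.
  by rewrite !hornerE normcM normcX.
have lcx := lc x rx.
(* If [Q] is constant in the outer variable, [key] says that its coefficient vanishes at [x],
   against the lower bound [c]. *)
case: (size Q).-1 key => [|d] key.
  move: key; rewrite big_ord0 expr0 mulr1 => /(le_trans lcx).
  by rewrite leNgt c0.
have td : 0 < normc t ^+ d by rewrite exprn_gt0 // (lt_le_trans ltr01).
rewrite -(ler_pM2r td) (_ : _ * c * _ = c * normc t ^+ d.+1); last first.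
  by rewrite exprS; ring.
apply: (@le_trans _ _ (normc (lead_coef Q).[x] * normc t ^+ d.+1)).
  by rewrite ler_wpM2r // exprn_ge0 // normc_ge0.
apply: le_trans key _; rewrite mulr_suml ler_sum // => j _.
rewrite ler_wpM2l ?normc_ge0 // ler_weXn2l //.
by rewrite -ltnS.
Qed.

Lemma nash_growth (D E : set C) (g : C -> C) :
  complex_nash D g -> (E `<=` D)%classic -> connected E ->
  exists (m : nat) (M r : R), [/\ 0 <= M, 1 <= r
    & forall z, E z -> r <= normc z -> normc (g z) <= M * normc z ^+ m].
Proof.
move=> gD ED Ec; have [Q Q0 gQ] := nash_global_equation gD ED Ec.
have [m [M [r [M0 r1 h]]]] := algebraic_growth Q0.
by exists m, M, r; split=> // z Ez rz; apply: h => //; exact: gQ.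
Qed.

End Continuation.

(** * From the components of the stem function to the slice function *)

Section SliceFunctions.
#[local] Set Implicit Arguments.
#[local] Unset Strict Implicit.
Import Normc.
Context {R : realType}.
Local Notation C := (Cplx R).

(** With [r] at least 1 the exponent [m] can be raised freely, so bounds with different exponents
    add up. *)
Definition poly_growth (E : set C) (h : C -> R) :=
  exists (m : nat) (M r : R), [/\ 0 <= M, 1 <= r
    & forall z, E z -> r <= normc z -> h z <= M * normc z ^+ m].

Lemma poly_growthD E (h k : C -> R) :
  poly_growth E h -> poly_growth E k -> poly_growth E (fun z => h z + k z).
Proof.
move=> [m [M [r [M0 r1 hM]]]] [n [N [s [N0 s1 kN]]]].
exists (m + n)%N, (M + N), (Num.max r s); split; first exact: addr_ge0.
  by rewrite le_max r1.
move=> z Ez; rewrite ge_max => /andP[rz sz].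
have z1 : 1 <= normc z := le_trans r1 rz.
rewrite mulrDl lerD //.
  by rewrite (le_trans (hM z Ez rz)) // ler_wpM2l // ler_weXn2l // leq_addr.
by rewrite (le_trans (kN z Ez sz)) // ler_wpM2l // ler_weXn2l // leq_addl.
Qed.

Lemma poly_growthM E (h : C -> R) (c : R) : 0 <= c ->
  poly_growth E h -> poly_growth E (fun z => h z * c).
Proof.
move=> c0 [m [M [r [M0 r1 hM]]]]; exists m, (M * c), r; split=> //.
  exact: mulr_ge0.
by move=> z Ez rz; rewrite mulrAC ler_wpM2r // hM.
Qed.

Lemma poly_growth_sum E n (h : 'I_n -> C -> R) :
  (forall i, poly_growth E (h i)) -> poly_growth E (fun z => \sum_i h i z).
Proof.
move=> hE; rewrite (_ : (fun _ => _) = \sum_i h i); last first.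
  by apply/funext => z; rewrite fct_sumE.
apply: big_ind => //; last by move=> h1 h2; exact: poly_growthD.
by exists 0%N, 0, 1; split=> // z _ _; rewrite mul0r.
Qed.

(* [a + b I] is sent to [a + iota |b|]. *)
Definition slice_coord n (x : cd R n) : C :=
  ((cdre x) +i* (Num.sqrt (cdsq x - cdre x ^+ 2)))%C.

Lemma slice_coord_continuous n : continuous (@slice_coord n).
Proof.
move=> x.
pose p (y : cd R n) : R := Num.sqrt (cdsq y - cdre y ^+ 2).
have pc : {for x, continuous p}.
  apply: (@continuous_comp _ _ _ (fun y : cd R n => cdsq y - cdre y ^+ 2)
    Num.sqrt).
    apply: (@continuousB R R^o); first exact: cdsq_continuous.
    apply: (@continuous_comp _ _ _ (@cdre R n) (fun t : R => t ^+ 2)).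
      exact: cdre_continuous.
    exact: exprn_continuous.
  exact: sqrt_continuous.
have sc : {for x, continuous (fun y : cd R n =>
    ((cdre y)%:C + 'i * (p y)%:C)%C : C)}.
  apply: (@continuousD R[i] C).
    apply: (@continuous_comp _ _ _ (@cdre R n) (fun t => (t%:C)%C : C)).
      exact: cdre_continuous.
    exact: real_complex_continuous.
  apply: (@continuousM R[i]); first exact: cst_continuous.
  apply: (@continuous_comp _ _ _ p (fun t => (t%:C)%C : C)) => //.
  exact: real_complex_continuous.
rewrite (_ : @slice_coord n = (fun y => ((cdre y)%:C + 'i * (p y)%:C)%C)) //.
by apply/funext => y; rewrite [LHS]complexE.
Qed.

Variable A : division_algebra.
Local Notation n := (cd_level A).

Lemma anormE (x : alg R A) : anorm x = Num.sqrt (cdsq x).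
Proof. by rewrite /anorm /amul cdre_mul_conj. Qed.

Lemma anorm_le (x : alg R A) : anorm x <= 2 ^+ n * `|x|.
Proof.
rewrite anormE -[leRHS]ger0_norm; last by rewrite mulr_ge0 // exprn_ge0.
rewrite -sqrtr_sqr ler_wsqrtr // (le_trans (cdsq_le x)) // exprMn.
by rewrite ler_wpM2r ?sqr_ge0 // expr2 ler_peMl ?exprn_ge0 // exprn_ege1 // ler1n.
Qed.

Lemma norm_le1 (x : alg R A) : cdsq x = 1 -> `|x| <= 1.
Proof. by move=> sx; have := le_cdsq x; rewrite sx expr_le1. Qed.

Lemma norm_imag_unit (I : alg R A) : imag_units I -> `|I| <= 1.
Proof. by move=> /cd_imag_unit[_]; exact: norm_le1. Qed.

Lemma norm_slice_point (I : alg R A) (a b : R) : imag_units I ->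
  `|slice_point I a b| <= `|a| + `|b|.
Proof.
move=> I1; rewrite (le_trans (ler_normD _ _)) // !normrZ.
have n1 : `|cd1 R n| <= 1.
  apply: norm_le1; have := cdsq_slice 1 0 (cd1 R n).
  by rewrite scale1r scale0r addr0 mulr0 mul0r addr0 expr0n mul0r addr0 expr1n.
by rewrite lerD // ler_piMr // norm_imag_unit.
Qed.

Lemma slice_coord_point (a b : R) (I : alg R A) : imag_units I ->
  slice_coord (slice_point I a b) = (a +i* `|b|)%C /\
  normc (slice_coord (slice_point I a b)) = anorm (slice_point I a b).
Proof.
move=> I1; have [reI sqI] := cd_imag_unit I1.
have sx : cdsq (slice_point I a b) = a ^+ 2 + b ^+ 2.
  by rewrite cdsq_slice reI sqI mulr0 addr0 mulr1.
have rx : cdre (slice_point I a b) = a.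
  by rewrite cdreD !cdreZ cdre1 reI mulr1 mulr0 addr0.
have e : slice_coord (slice_point I a b) = (a +i* `|b|)%C.
  by rewrite /slice_coord sx rx addrC addKr sqrtr_sqr.
by rewrite e anormE sx /= real_normK ?num_real.
Qed.

Lemma slice_coord_circularization (D : set C) (x : alg R A) :
  conj_invariant D -> circularization D x ->
  exists I : alg R A, [/\ D (slice_coord x), imag_units I,
    x = slice_point I (complex.Re (slice_coord x)) (complex.Im (slice_coord x))
    & normc (slice_coord x) = anorm x].
Proof.
move=> Dc [[a b] [I [Dz I1 ->]]].
have [e ->] := slice_coord_point a b I1; rewrite e.
have [b0|b0] := leP 0 b; first by exists I; rewrite ger0_norm.
(* For negative [b] the same point is written with [- I] and the conjugate parameter, which lies in
   [D] by invariance. *)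
exists (- I); rewrite ltr0_norm //; split => //; first exact: (Dc _ Dz).
  by rewrite /imag_units /amul /= cdmulNl cdmulNr opprK.
by rewrite /slice_point scaleNr scalerN opprK.
Qed.

Lemma slice_components_growth (D E : set C) (F : C -> tensorC R A) :
  (E `<=` D)%classic -> connected E -> stem_nash D F ->
  poly_growth E (fun z => `|(F z).1| + `|(F z).2|).
Proof.
move=> ED Ec [I [J [I1 _ [G1 [G2 [FG GN]]]]]].
have norm_part (a b : 'I_(udim A).+1 -> R) :
    `|\sum_k amul (slice_point I (a k) (b k)) (J k)| <=
    \sum_k (`|a k| + `|b k|) * (2 ^+ n * `|J k|).
  rewrite (le_trans (ler_norm_sum _ _ _)) // ler_sum // => k _.
  rewrite (le_trans (cd_norm_mul _ _)) // mulrAC mulrC ler_wpM2r //.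
  exact: norm_slice_point.
pose h z := \sum_k (normc (G1 k z) + normc (G2 k z)) * (2 ^+ n * `|J k|).
(* The factor 2 serves [(F z).1] and [(F z).2]: [h z] bounds each, as real and imaginary parts are
   at most the modulus. *)
have [m [M [r [M0 r1 hM]]]] : poly_growth E (fun z => h z * 2).
  apply: poly_growthM => //; apply: poly_growth_sum => k.
  apply: poly_growthM; first by rewrite mulr_ge0 // exprn_ge0.
  by have [g1 g2] := GN k; apply: poly_growthD; apply: (@nash_growth _ D).
exists m, M, r; split=> // z Ez rz; apply: le_trans (hM z Ez rz).
have [-> ->] := FG z (ED z Ez).
have re_le (w : R[i]) : `|complex.Re w| <= normc w.
  by case: w => a b /=; rewrite -sqrtr_sqr ler_wsqrtr // lerDl sqr_ge0.
have im_le (w : R[i]) : `|complex.Im w| <= normc w.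
  by case: w => a b /=; rewrite -sqrtr_sqr ler_wsqrtr // lerDr sqr_ge0.
rewrite mulr_natr mulr2n lerD // (le_trans (norm_part _ _)) // ler_sum // => k _;
  by rewrite ler_wpM2r ?lerD // mulr_ge0 // exprn_ge0.
Qed.

End SliceFunctions.

Theorem proposition6p12 (R : realType) (A : division_algebra)
    (Omega : set (alg R A)) (f : alg R A -> alg R A)
    (hOmega : circular_domain Omega) (hunb : aunbounded Omega)
    (hf : slice_nash Omega f) :
  exists (m : nat) (C r : R),
    [/\ 1 <= C, 1 <= r
      & forall x : alg R A, Omega x -> r <= anorm x ->
          anorm (f x) <= C * (1 + anorm x ^+ m)].
Proof.
have [_ Oc _] := hOmega; have [D [F [eO [_ Dc _] ind _ nashF]]] := hf.
(* [D] may be disconnected, for instance two conjugate half-planes, while [E] inherits connectedness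
   from [Omega]. *)
pose E := [set slice_coord x | x in Omega]%classic.
have Ec : connected E.
  apply: connected_continuous_connected Oc _.
  by apply: continuous_subspaceT; exact: slice_coord_continuous.
have ED : (E `<=` D)%classic.
  by move=> _ [x + <-]; rewrite eO => /(slice_coord_circularization Dc)[I []].
have [m [M [r [M0 r1 FM]]]] := slice_components_growth ED Ec nashF.
(* One power of 2 compares [anorm] with the sup norm, the other bounds the product of [I] and the
   second stem component. *)
pose K : R := 2 ^+ cd_level A * 2 ^+ cd_level A.
have n1 : 1 <= 2 ^+ cd_level A :> R by rewrite exprn_ege1 // ler1n.
have K0 : 0 <= K by rewrite mulr_ge0 // exprn_ge0.
exists m, (1 + K * M), r; split=> // [|x Ox rx].
  by rewrite lerDl mulr_ge0.
have Cx : circularization D x by rewrite -eO.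
have [I [Dz I1 ex nz]] := slice_coord_circularization Dc Cx.
have FMx : `|(F (slice_coord x)).1| + `|(F (slice_coord x)).2| <= M * anorm x ^+ m.
  by rewrite -nz; apply: FM; [exists x | rewrite nz].
have x0 : 0 <= anorm x ^+ m by rewrite exprn_ge0 // (le_trans _ rx) // (le_trans _ r1).
apply: (@le_trans _ _ (K * M * anorm x ^+ m)); last first.
  have KM : 0 <= K * M by rewrite mulr_ge0.
  by nra.
rewrite -mulrA (le_trans _ (ler_wpM2l K0 FMx)) //.
rewrite (le_trans (anorm_le _)) // /K -mulrA ler_wpM2l ?exprn_ge0 //.
rewrite {1}ex (ind _ _ Dz I1) (le_trans (ler_normD _ _)) // mulrDr lerD //.
  by rewrite ler_peMl.
rewrite (le_trans (cd_norm_mul _ _)) // -mulrA ler_wpM2l ?exprn_ge0 //.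
by rewrite ler_piMl // norm_imag_unit.
Qed.
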